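(* Let $n\ge 1$. There is a partial order on $\mathrm{Alt}_n$ such that the edge-labeling $\lambda$ of the cover relations of $\Phi_n$ which assigns $\lambda(I\lessdot J)=\mathbf{1}_J-\mathbf{1}_I\in \mathrm{Alt}_n$ is an EL-labeling of $\Phi_n$ and, furthermore, any of the EL-shelling orders associated with this labeling is a linear order on $\mathrm{MT}_n$ that extends the weak order $<_W$.
   Context: Notation: $[n]=\{1,\ldots,n\}$; for $S\subseteq[n]$, $\mathbf{1}_S\in\{0,1\}^n$ is the indicator vector of $S$. $\mathrm{Alt}_n$ is the set of vectors in $\{0,+1,-1\}^n$ whose nonzero entries alternate in sign, beginning and ending with $+1$. If $I=\{i_1<\cdots<i_m\}$ and $J=\{j_1<\cdots<j_{m+1}\}$ are subsets of $[n]$, say $J$ interlaces $I$ if $j_1\le i_1\le j_2\le\cdots\le j_m\le i_m\le j_{m+1}$; this is equivalent to $\mathbf{1}_J-\mathbf{1}_I\in\mathrm{Alt}_n$. $\Phi_n$ is the partial order on all subsets of $[n]$ that is the (reflexive) transitive closure of the relations $I<J$ where $\#J=\#I+1$ and $J$ interlaces $I$; these relations are its cover relations $I\lessdot J$. A monotone triangle of size $n$ is a sequence $T=(T_0,T_1,\ldots,T_n)$ of subsets of $[n]$ with $\#T_m=m$ and $T_{m+1}$ interlacing $T_m$ for $0\le m<n$; $\mathrm{MT}_n$ is the set of all of these, which are exactly the maximal chains of $\Phi_n$. EL-labelings: for a poset $P$ with set of cover relations $C(P)$, and a poset $(\Lambda,<_\Lambda)$, a function $\lambda:C(P)\to\Lambda$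 is an EL-labeling if (i) for every interval $[x,y]\subseteq P$ there is a unique maximal chain $x=x_0\lessdot x_1\lessdot\cdots\lessdot x_k=y$ with weakly rising labels $\lambda(x_0,x_1)\le_\Lambda\lambda(x_1,x_2)\le_\Lambda\cdots\le_\Lambda\lambda(x_{k-1},x_k)$; and (ii) with $x_1$ the second element of that chain, if $x\lessdot z<y$ and $z\ne x_1$ then $\lambda(x,x_1)<_\Lambda\lambda(x,z)$. The EL-shelling orders associated with an EL-labeling are the total orders on the maximal chains that are linear extensions of the partial order comparing two maximal chains lexicographically through their label sequences (read from bottom to top): one chain precedes another if, at the first position where their label sequences differ, its label is $<_\Lambda$ the label of the other. Weak order: for $T\in\mathrm{MT}_n$ and $1\le i\le n-1$, with $T_{i-1}=\{a_1<\cdots<a_{i-1}\}$ and $T_{i+1}=\{b_1<\cdots<b_{i+1}\}$, let $T\times\pi_i$ be the monotone triangle obtained from $T$ by replacing the row $T_i$ with $\{h_1<\cdots<h_i\}$, where $h_m=\max(a_{m-1},b_m)$ and $a_0:=0$. The weak order $\le_W$ on $\mathrm{MT}_n$ is the reflexive transitive closure of the relations $T\times\pi_i\le_W T$. A linear order on $\mathrm{MT}_n$ extends $<_W$ if $T'<_W T$ implies $T'$ comes before $T$. *)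

(* Defs.v *)
From HB Require Import structures.
From mathcomp Require Import all_boot all_order all_algebra.

Set Implicit Arguments.
Unset Strict Implicit.
Unset Printing Implicit Defensive.

Import Order.TTheory GRing.Theory Num.Theory.

(* The set [n] = {1, ..., n} is represented by 'I_n = {0, ..., n-1}. *)

Section OrderedLabels.
Variables (L : eqType) (A : {pred L}) (leL : rel L).

Definition partial_order_on : Prop :=
  [/\ {in A, reflexive leL}, {in A &, antisymmetric leL}
    & {in A & &, transitive leL}].

Definition linear_order_on : Prop := partial_order_on /\ {in A &, total leL}.

Definition strict (a b : L) : bool := (a != b) && leL a b.

(* At the first position where the two words differ, u has the smaller
   letter. *)
Definition lex_before (u v : seq L) : Prop :=
  exists p a b u' v',
    [/\ u = p ++ a :: u', v = p ++ b :: v' & strict a b].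

End OrderedLabels.

Section ELLabelings.
Local Open Scope order_scope.
Variables (d : Order.disp_t) (P : finPOrderType d).

Definition covers : rel P :=
  [rel x y | (x < y) && [forall z, ~~ ((x < z) && (z < y))]].

(* [x :: s] is a maximal chain x = x_0 <. x_1 <. ... <. x_k = y of the
   interval [x, y]. *)
Definition chain_between (x y : P) (s : seq P) : bool :=
  path covers x s && (last x s == y).

(* Chains are listed increasingly, so inclusion of chains is [subseq]. *)
Definition maximal_chain (c : seq P) : Prop :=
  sorted <%O c /\ (forall c', sorted <%O c' -> subseq c c' -> c' = c).

Variables (L : eqType) (A : {pred L}) (leL : rel L) (lam : P -> P -> L).

Definition labels_from (x : P) (s : seq P) : seq L := pairmap lam x s.

Definition labels (c : seq P) : seq L :=
  if c is x :: s then labels_from x s else [::].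

Definition rising_chain (x y : P) (s : seq P) : bool :=
  chain_between x y s && sorted leL (labels_from x s).

(* The label poset is the set A, on which leL is meant to be a partial order
   (leL is irrelevant outside A); only the values of lam on
   cover relations are meaningful. *)
Definition EL_labeling : Prop :=
  [/\ forall x y, covers x y -> lam x y \in A,
      forall x y, x <= y -> exists! s, rising_chain x y s
    & forall x y x1 s, rising_chain x y (x1 :: s) ->
      forall z, covers x z -> z < y -> z != x1 ->
        strict leL (lam x x1) (lam x z)].

(* r, restricted to the maximal chains, is a total order that extends the
   lexicographic partial order. *)
Definition EL_shelling_order (r : rel (seq P)) : Prop :=
  [/\ forall c, maximal_chain c -> r c c,
      forall c1 c2, maximal_chain c1 -> maximal_chain c2 ->
        r c1 c2 -> r c2 c1 -> c1 = c2,
      forall c1 c2 c3,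
        maximal_chain c1 -> maximal_chain c2 -> maximal_chain c3 ->
        r c1 c2 -> r c2 c3 -> r c1 c3,
      forall c1 c2, maximal_chain c1 -> maximal_chain c2 -> r c1 c2 || r c2 c1
    & forall c1 c2, maximal_chain c1 -> maximal_chain c2 ->
        lex_before leL (labels c1) (labels c2) -> r c1 c2].

End ELLabelings.

Section Interlacing.
Variable n : nat.
Implicit Types I J : {set 'I_n}.

(* [enum] lists the elements of a set of ordinals increasingly. *)
Definition elts I : seq nat := [seq val i | i <- enum I].

(* The condition #J = #I + 1 is included. *)
Definition interlaces J I : bool :=
  (#|J| == #|I|.+1) &&
  [forall k : 'I_#|I|,
     nth 0 (elts J) k <= nth 0 (elts I) k <= nth 0 (elts J) k.+1].

Definition interlace_step : rel {set 'I_n} := [rel I J | interlaces J I].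

Lemma connect_interlace_card I J :
  connect interlace_step I J -> I = J \/ #|I| < #|J|.
Proof.
case/connectP=> p; elim: p I => [|K p IHp] I /=; first by move=> _ ->; left.
case/andP=> /andP[/eqP cardK _] /IHp{}IHp /IHp[<-|]; rewrite cardK.
  by right.
by move=> ltKJ; right; apply: ltnW.
Qed.

Lemma connect_interlace_anti : antisymmetric (connect interlace_step).
Proof.
move=> I J /andP[/connect_interlace_card[//|ltIJ]].
by case/connect_interlace_card=> [//|/(ltn_trans ltIJ)]; rewrite ltnn.
Qed.

End Interlacing.

Definition Phi (n : nat) : Type := {set 'I_n}.

Fact Phi_display : Order.disp_t. Proof. exact: Order.Disp tt tt. Qed.

HB.instance Definition _ (n : nat) := Finite.on (Phi n).
HB.instance Definition _ (n : nat) :=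
  Order.Le_isPOrder.Build Phi_display (Phi n)
    (@connect0 _ (@interlace_step n)) (@connect_interlace_anti n)
    (@connect_trans _ (@interlace_step n)).

Section AlternatingVectors.
Local Open Scope ring_scope.
Variable n : nat.

Definition nonzero_entries (v : 'rV[int]_n) : seq int :=
  [seq x <- [seq v 0 i | i <- enum 'I_n] | x != 0].

(* The defaults of [head] and [last] are 0, which excludes the zero vector. *)
Definition Alt : {pred 'rV[int]_n} :=
  [pred v : 'rV[int]_n |
    [&& [forall i, v 0 i \in [:: 0; 1; -1]],
        head 0 (nonzero_entries v) == 1,
        last 0 (nonzero_entries v) == 1
      & sorted (fun x y => y == - x) (nonzero_entries v)]].

Definition indicator (S : {set 'I_n}) : 'rV[int]_n := \row_i (i \in S)%:R.

Definition Phi_label (I J : Phi n) : 'rV[int]_n := indicator J - indicator I.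

End AlternatingVectors.

Section MonotoneTriangles.
Variable n : nat.

Definition is_monotone_triangle (T : n.+1.-tuple (Phi n)) : bool :=
  [forall m : 'I_n.+1, #|(tnth T m : {set 'I_n})| == m] &&
  [forall m : 'I_n, interlaces (nth set0 T m.+1) (nth set0 T m)].

Definition MT : Type := {T : n.+1.-tuple (Phi n) | is_monotone_triangle T}.

(* The maximal chain of Phi n given by the rows of T. *)
Definition rows (T : MT) : seq (Phi n) := val T.

Definition row (T : MT) (m : nat) : {set 'I_n} := nth set0 (rows T) m.

(* The set {h_1 < ... < h_i} with h_m = max(a_{m-1}, b_m), where a and b list
   rows i-1 and i+1 of T; m is shifted by one, and a_0 = 0 is below every
   element in either numbering of [n]. *)
Definition pi_row (T : MT) (i : nat) : {set 'I_n} :=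
  [set h : 'I_n | [exists m : 'I_i,
     val h == maxn (nth 0 (0 :: elts (row T i.-1)) m)
                   (nth 0 (elts (row T i.+1)) m)]].

Definition pi_rows (T : MT) (i : nat) : seq (Phi n) :=
  set_nth set0 (rows T) i (pi_row T i).

(* T' = T x pi_i for some 1 <= i <= n-1. *)
Definition weak_step : rel MT :=
  [rel T' T | [exists i : 'I_n, (0 < i) && (rows T' == pi_rows T i)]].

Definition weak_le : rel MT := connect weak_step.

Definition weak_lt : rel MT := [rel T' T | (T' != T) && weak_le T' T].

Definition extends_weak_order (r : rel MT) : Prop :=
  forall T' T, weak_lt T' T -> (T' != T) && r T' T.

End MonotoneTriangles.

(* Main.v *)
Require Import Defs.
From mathcomp Require Import all_boot all_order all_algebra.
From mathcomp Require Import zify.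

(** Everything is read off from counting functions.  Write N_S(k) for the
    number of elements of S below k.  Then J interlaces I exactly when
    #J = #I + 1 and N_J - N_I takes only the values 0 and 1
    ([interlacesP]), and more generally I <= J in Phi_n exactly when
    q = N_J - N_I takes values between 0 and #J - #I ([Phi_leP]).  The label
    of a cover has N_J - N_I as its sequence of prefix sums, a 0/1 sequence
    ending in 1, and such sequences are precisely the prefix sums of
    alternating vectors.

    Order the labels by reverse pointwise comparison of prefix sums, so that
    Alt_n becomes a Boolean lattice.  Along a chain from I to J the prefix
    sums of the labels add up to q, so if they decrease weakly at every
    position then the first label must have prefix sums min(1, q): at a
    position where the first label contributes 0, all later ones do as well
    ([rising_chain_head]).  This gives uniqueness of the rising chain, and
    min(1, q) is also the largest prefix sum function that a first step
    inside [I, J] may have, which is the second axiom.  For existence,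
    N_I + min(1, q) has to be the counting function of a set; it is, because
    q changes by at most 1 at a time, so each increment of N_I + min(1, q)
    agrees with that of N_I or with that of N_J ([below_first_step]).

    Finally T x pi_i replaces row i by the entrywise smallest row that fits
    between rows i-1 and i+1 ([below_pi_row]).  A smaller row has larger
    counts, so the first label in which T x pi_i and T differ is smaller for
    T x pi_i, and every shelling order puts T x pi_i first. *)

Set Implicit Arguments.
Unset Strict Implicit.
Unset Printing Implicit Defensive.

Import Order.TTheory GRing.Theory Num.Theory.

(** * Counting functions of subsets *)

Lemma nth_sorted_ltn (s : seq nat) m k :
  sorted ltn s -> m < size s ->
  (nth 0 s m < k) = (m < count (fun x => x < k) s).
Proof.
elim: s m => [//|x s IHs] m /= xs.
have ltxs : all (ltn x) s by move: xs; rewrite (path_sortedE ltn_trans); case/andP.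
have none_below : k <= x -> count (fun y => y < k) s = 0.
  move=> lekx; apply/eqP; rewrite -leqn0 leqNgt -has_count -all_predC.
  by apply/allP=> y /(allP ltxs) /= ltxy; rewrite -leqNgt (leq_trans lekx (ltnW ltxy)).
case: m => [_|m lt_m] /=.
  by case: (ltnP x k) => [//|/none_below ->].
rewrite ltnS in lt_m; rewrite IHs ?(path_sorted xs) //.
by case: (ltnP x k) => [//|/none_below ->].
Qed.

Section Counting.
Variable n : nat.
Implicit Types (I J K S : {set 'I_n}).

Definition below S k : nat := \sum_(x in S) (x < k).

Lemma elts_sorted S : sorted ltn (elts S).
Proof.
have sub : subseq (elts S) (iota 0 n).
  rewrite -val_enum_ord /elts; apply: map_subseq.
  by rewrite {1}/enum_mem -enumT; apply: filter_subseq.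
by apply: (subseq_sorted ltn_trans sub); apply: iota_ltn_sorted.
Qed.

Lemma size_elts S : size (elts S) = #|S|.
Proof. by rewrite size_map -cardE. Qed.

Lemma below_count S k : below S k = count (fun x => x < k) (elts S).
Proof. by rewrite -sum1_count big_map big_enum_cond /= big_mkcondr. Qed.

Lemma nth_elts_ltn S m k :
  m < #|S| -> (nth 0 (elts S) m < k) = (m < below S k).
Proof.
by move=> ltmS; rewrite below_count nth_sorted_ltn ?elts_sorted ?size_elts.
Qed.

Lemma below_le_card S k : below S k <= #|S|.
Proof. by rewrite below_count -size_elts count_size. Qed.

Lemma below0 S : below S 0 = 0.
Proof. by apply: big1. Qed.

Lemma below_oversize S k : n <= k -> below S k = #|S|.
Proof.
move=> lenk; rewrite -sum1_card; apply: eq_bigr => x _.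
by rewrite (leq_trans (ltn_ord x) lenk).
Qed.

Lemma belowS S (x : 'I_n) : below S x.+1 = below S x + (x \in S).
Proof.
rewrite /below (eq_bigr (fun y : 'I_n => (y < x) + (y == x))); last first.
  by move=> y _; rewrite -val_eqE /=; lia.
rewrite big_split /=; congr (_ + _).
have [xS|xS] := boolP (x \in S).
  rewrite (bigD1 x) //= eqxx big1 // => y /andP[_ /negPf ->] //.
by rewrite big1 // => y yS; case: eqP xS => // <-; rewrite yS.
Qed.

Lemma below_inj S S' : below S =1 below S' -> S = S'.
Proof.
move=> eqSS'; apply/setP=> x; have := eqSS' x.+1.
by rewrite !belowS eqSS' => /addnI; case: (x \in S) (x \in S') => [] [].
Qed.

(** The entries of a set satisfy x_m < k exactly when the count below k
    exceeds m, so the inequalities between entries, tested against every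
    threshold k, become inequalities between counts. *)
Lemma interlacesP J I :
  reflect (#|J| = #|I|.+1 /\ forall k, below I k <= below J k <= (below I k).+1)
          (interlaces J I).
Proof.
apply: (iffP andP) => [[/eqP cardJ /forallP lace]|[cardJ cmp]].
  split=> // k; apply/andP; split; rewrite leqNgt; apply/negP=> bad.
    have ltI : below J k < #|I| by apply: leq_trans bad (below_le_card _ _).
    have /andP[leJI _] := lace (Ordinal ltI).
    have : nth 0 (elts J) (below J k) < k.
      by apply: leq_ltn_trans leJI _; rewrite nth_elts_ltn.
    by rewrite nth_elts_ltn ?ltnn // cardJ ltnW.
  have ltJ : (below I k).+1 < #|J| by apply: leq_trans bad (below_le_card _ _).
  have ltI : below I k < #|I| by rewrite cardJ ltnS in ltJ.
  have /andP[_ leIJ] := lace (Ordinal ltI).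
  have : nth 0 (elts I) (below I k) < k.
    by apply: leq_ltn_trans leIJ _; rewrite nth_elts_ltn.
  by rewrite nth_elts_ltn ?ltnn.
split; first by rewrite cardJ.
apply/forallP=> m; have ltm := ltn_ord m.
have /andP[leIJ _] := cmp (nth 0 (elts I) m).+1.
have /andP[_ leJI] := cmp (nth 0 (elts J) m.+1).+1.
apply/andP; split.
  rewrite -ltnS nth_elts_ltn; last by rewrite cardJ ltnW.
  by apply: leq_trans leIJ; rewrite -nth_elts_ltn ?leqnn.
rewrite -ltnS nth_elts_ltn // -ltnS; apply: leq_trans leJI.
by rewrite -nth_elts_ltn ?leqnn // cardJ.
Qed.

(** * The order of Phi in terms of counts *)

Definition dominates I J : Prop :=
  forall k, below I k <= below J k /\ #|I| + below J k <= #|J| + below I k.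

(** The set that takes its elements from J wherever the gap between the
    counting functions of I and J stays at most 1, and from I elsewhere: its
    counts exceed those of I by the gap truncated at 1. *)
Definition first_step I J : {set 'I_n} :=
  [set x : 'I_n | if (below J x <= (below I x).+1) &&
                     (below J x.+1 <= (below I x.+1).+1)
                  then x \in J else x \in I].

Lemma below_first_step I J k :
  dominates I J ->
  below (first_step I J) k = below I k + minn 1 (below J k - below I k).
Proof.
move=> domIJ; elim: k => [|k IHk]; first by rewrite !below0.
have [lenk|ltkn] := leqP n k.
  have sat S : below S k.+1 = below S k by rewrite !below_oversize // leqW.
  by rewrite !sat.
have [x defk] : exists x : 'I_n, k = x by exists (Ordinal ltkn).
rewrite {k ltkn}defk in IHk *.
have [lex _] := domIJ x; have [] := domIJ x.+1.
rewrite !belowS IHk inE !belowS.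
by case: (x \in I) (x \in J) => [] []; case: ifP => /=; lia.
Qed.

Lemma card_below S : #|S| = below S n.
Proof. by rewrite below_oversize. Qed.

Lemma first_step_interlaces I J :
  dominates I J -> #|I| < #|J| -> interlaces (first_step I J) I.
Proof.
move=> domIJ ltIJ; apply/interlacesP; split=> [|k].
  by rewrite card_below below_first_step // -!card_below; lia.
by rewrite below_first_step //; lia.
Qed.

Lemma dominates_first_step I J :
  dominates I J -> #|I| < #|J| -> dominates (first_step I J) J.
Proof.
move=> domIJ ltIJ k; have /interlacesP[-> _] := first_step_interlaces domIJ ltIJ.
by have [] := domIJ k; rewrite below_first_step //; lia.
Qed.

Lemma interlaces_dominates I J : interlaces J I -> dominates I J.
Proof. by case/interlacesP=> cardJ cmp k; have := cmp k; lia. Qed.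

Lemma dominates_eq I J : dominates I J -> #|I| = #|J| -> I = J.
Proof. by move=> domIJ cardIJ; apply: below_inj => k; have := domIJ k; lia. Qed.

(** The bounds on counts add up along a chain of covers.  Conversely,
    iterating [first_step] reaches J from any I that it dominates, because a
    step lowers every positive gap by exactly 1. *)
Lemma Phi_leP (I J : Phi n) : (I <= J)%O <-> dominates I J.
Proof.
split=> [/connectP[s]|].
  elim: s I => [|K s IHs] I /=; first by move=> _ -> k.
  case/andP=> /interlaces_dominates domIK /IHs{}IHs /IHs domKJ k.
  by have := domIK k; have := domKJ k; lia.
move=> domIJ; have [m cardJ] : exists m, #|I| + m = #|J|.
  by exists (#|J| - #|I|); rewrite subnKC // !card_below; case: (domIJ n).
elim: m I domIJ cardJ => [|m IHm] K domKJ cardJ.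
  have -> : K = J by apply: dominates_eq => //; lia.
  exact: connect0.
have ltKJ : #|K| < #|J| by lia.
have laceKJ := first_step_interlaces domKJ ltKJ.
apply: (@le_trans _ _ (first_step K J : Phi n)); first exact: connect1.
apply: IHm; first exact: dominates_first_step.
by case/interlacesP: laceKJ => ->; lia.
Qed.

Lemma interlaces_le (I J : Phi n) : interlaces J I -> (I <= J)%O.
Proof. by move=> laceIJ; apply/Phi_leP/interlaces_dominates. Qed.

Lemma Phi_lt_card (I J : Phi n) : (I < J)%O -> #|I| < #|J|.
Proof.
rewrite lt_neqAle => /andP[neqIJ /connect_interlace_card[eqIJ|//]].
by rewrite eqIJ eqxx in neqIJ.
Qed.

Lemma coversE (I J : Phi n) : covers I J = interlaces J I.
Proof.
apply/idP/idP=> [/andP[ltIJ /forallP noz]|laceIJ].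
  have domIJ : dominates I J by apply/Phi_leP/ltW.
  have cardIJ := Phi_lt_card ltIJ.
  have laceIK := first_step_interlaces domIJ cardIJ.
  have leKJ : ((first_step I J : Phi n) <= J)%O.
    by apply/Phi_leP/dominates_first_step.
  have ltIK : (I < first_step I J :> Phi n)%O.
    rewrite lt_neqAle (interlaces_le laceIK) andbT.
    by apply/eqP=> eqIK; case/interlacesP: laceIK; rewrite -eqIK; lia.
  have := noz (first_step I J); rewrite ltIK /= lt_neqAle leKJ andbT negbK.
  by move=> /eqP eqKJ; rewrite -[X in interlaces X _]eqKJ.
have [cardJ _] := interlacesP _ _ laceIJ.
apply/andP; split.
  rewrite lt_neqAle (interlaces_le laceIJ) andbT.
  by apply/eqP=> eqIJ; move: cardJ; rewrite eqIJ; lia.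
apply/forallP=> K; apply/negP=> /andP[/Phi_lt_card ? /Phi_lt_card].
by rewrite cardJ; lia.
Qed.

(** * The labels and their order *)

Local Open Scope ring_scope.

Implicit Types (u v w : 'rV[int]_n).

Definition psum v (k : nat) : int := \sum_(i < n | (i < k)%N) v 0 i.

(** Larger prefix sums mean that the added elements come earlier, so of two
    covers of the same set the one with the entrywise smaller top gets the
    smaller label; all covers of a set are ordered by their tops in this way
    ([label_leE]). *)
Definition label_le : rel 'rV[int]_n :=
  [rel u v | [forall k : 'I_n.+1, psum v k <= psum u k]].

Lemma label_leP u v :
  reflect (forall k, psum v k <= psum u k) (label_le u v).
Proof.
apply: (iffP forallP) => [le_uv k|le_uv k]; last exact: le_uv.
have [lekn|ltnk] := leqP k n; first exact: (le_uv (Ordinal (lekn : (k < n.+1)%N))).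
have sat w : psum w k = psum w n.
  by apply: eq_bigl => i; rewrite ltn_ord (ltn_trans (ltn_ord i) ltnk).
by rewrite !sat; apply: (le_uv ord_max).
Qed.

Lemma psumS v (i : 'I_n) : psum v i.+1 = psum v i + v 0 i.
Proof.
rewrite /psum (bigD1 i) //= addrC; congr (_ + _).
by apply: eq_bigl => j; rewrite ltnS ltn_neqAle andbC -val_eqE.
Qed.

Lemma psum_inj u v : psum u =1 psum v -> u = v.
Proof.
move=> equv; apply/rowP=> i; apply: (@addrI _ (psum u i)).
by rewrite -psumS equv [in RHS]equv psumS.
Qed.

Lemma label_le_order (A : {pred 'rV[int]_n}) : partial_order_on A label_le.
Proof.
split=> [u _|u v _ _ /andP[/label_leP le_uv /label_leP le_vu]|v u w _ _ _].
- exact/label_leP.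
- by apply: psum_inj => k; apply/le_anti; rewrite le_uv le_vu.
- move=> /label_leP le_uv /label_leP le_vw; apply/label_leP=> k.
  exact: le_trans (le_vw k) (le_uv k).
Qed.

Lemma psum_label (I J : Phi n) k :
  psum (Phi_label I J) k = (below J k)%:Z - (below I k)%:Z.
Proof.
have psumE S : \sum_(i < n | (i < k)%N) (i \in S)%:R = (below S k)%:Z :> int.
  rewrite /below big_mkcond [in RHS]big_mkcond /= -natz natr_sum.
  by apply: eq_bigr => i _; case: (i \in S); case: ltnP.
rewrite /psum -!psumE -sumrB; apply: eq_bigr => i _.
by rewrite !mxE.
Qed.

Lemma label_leE (I J J' : Phi n) :
  label_le (Phi_label I J) (Phi_label I J') <->
  forall k, (below J' k <= below J k)%N.
Proof.
split=> [/label_leP le_lab k|le_below]; last apply/label_leP=> k.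
  by have := le_lab k; rewrite !psum_label; lia.
by have := le_below k; rewrite !psum_label; lia.
Qed.

Lemma strict_labelP (I J J' : Phi n) :
  J' != J -> (forall k, (below J' k <= below J k)%N) ->
  strict label_le (Phi_label I J) (Phi_label I J').
Proof.
move=> neqJ leJ; apply/andP; split; last exact/label_leE.
apply: contraNneq neqJ => eq_lab; apply/eqP/below_inj=> k.
by have := congr1 (psum^~ k) eq_lab; rewrite /= !psum_label; lia.
Qed.

End Counting.

(** A 0/1 sequence p alternately steps up and down; the starting state plays
    the part of a virtual nonzero entry preceding the first one, which makes
    the statement inductive. *)
Lemma alternating_steps (p : nat -> bool) m l :
  let sgn (b : bool) : int := if b then 1%R else (-1)%R in
  let s := [seq x <- [seq ((p k.+1)%:Z - (p k)%:Z)%R | k <- iota m l]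
           | x != 0%R] in
  path (fun x y => y == - x)%R (sgn (p m)) s /\
  last (sgn (p m)) s = sgn (p (m + l)).
Proof.
move=> sgn; elim: l m => [|l IHl] m /=; first by rewrite addn0.
have := IHl m.+1; rewrite addSnnS.
by case: (p m) (p m.+1) => [] [] /=.
Qed.

(** * The EL-labeling *)

Section Labeling.
Variable n : nat.
Implicit Types (I J K : Phi n).

Local Open Scope ring_scope.

Lemma cover_label_Alt I J : covers I J -> Phi_label I J \in @Alt n.
Proof.
rewrite coversE => /interlacesP[cardJ cmp].
pose p k := (below I k < below J k)%N.
have pE k : (p k)%:Z = (below J k)%:Z - (below I k)%:Z.
  by have := cmp k; rewrite /p; case: ltnP; lia.
have entry (i : 'I_n) : Phi_label I J 0 i = (p i.+1)%:Z - (p i)%:Z.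
  by rewrite !pE -!psum_label psumS addrAC subrr add0r.
have := alternating_steps p 0 n; rewrite add0n /=.
have -> : [seq (p k.+1)%:Z - (p k)%:Z | k <- iota 0 n] =
          [seq Phi_label I J 0 i | i <- enum 'I_n].
  by rewrite -val_enum_ord -map_comp; apply: eq_map => i /=; rewrite entry.
rewrite -/(nonzero_entries _).
have -> : p 0 = false by rewrite /p !below0.
have -> : p n = true by rewrite /p -!card_below cardJ ltnSn.
rewrite inE.
case: (nonzero_entries _) => [[//]|x s] /= [/andP[/eqP -> alt_s] last_s].
rewrite opprK in alt_s last_s *; rewrite eqxx alt_s last_s eqxx !andbT.
apply/forallP=> i; rewrite entry.
by case: (p i.+1) (p i) => [] [].
Qed.

Lemma path_covers_le I (s : seq (Phi n)) :
  path (@covers _ (Phi n)) I s -> (I <= last I s)%O.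
Proof.
elim: s I => [|K s IHs] I /=; first by rewrite lexx.
by case/andP=> /andP[/ltW leIK _] /IHs; apply: le_trans.
Qed.

(** Weakly rising labels that start below a label with prefix sum 0 at k all
    have prefix sum 0 at k. *)
Lemma rising_below_stationary v I (s : seq (Phi n)) k :
  path (@label_le n) v (labels_from (@Phi_label n) I s) ->
  psum v k <= 0 -> (below (last I s) k <= below I k)%N.
Proof.
elim: s v I => [//|K s IHs] v I /= /andP[/label_leP/(_ k) lev rise] v0.
have lab0 : psum (Phi_label I K) k <= 0 by apply: le_trans lev v0.
have := IHs _ _ rise lab0; move: lab0; rewrite psum_label; lia.
Qed.

(** Where the first label has prefix sum 0 the gap between I and J vanishes;
    where it has prefix sum 1 the gap is at least 1. *)
Lemma rising_chain_head I J K (s : seq (Phi n)) k :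
  rising_chain (@label_le n) (@Phi_label n) I J (K :: s) ->
  below K k = (below I k + minn 1 (below J k - below I k))%N.
Proof.
case/andP=> /andP[/= /andP[covIK chainK] /eqP lastJ] rise.
have := path_covers_le chainK; rewrite lastJ => /Phi_leP/(_ k)[leKJ _].
move: covIK; rewrite coversE => /interlacesP[_ /(_ k) cmpIK].
have := @rising_below_stationary (Phi_label I K) K s k rise.
by rewrite psum_label lastJ; lia.
Qed.

(** Iterating [first_step] gives rising labels: a later label can have prefix
    sum 1 at k only if the gap at k was not already closed by the first step,
    and then the first label has prefix sum 1 at k too. *)
Lemma rising_chain_exists I J :
  (I <= J)%O ->
  exists s, rising_chain (@label_le n) (@Phi_label n) I J s.
Proof.
move/Phi_leP; elim: {I}_.+1 {-2}I (ltnSn (#|J| - #|I|)) => [//|m IHm] I ltm domIJ.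
have [leJI|ltIJ] := leqP #|J| #|I|.
  exists [::]; rewrite /rising_chain /chain_between /= andbT; apply/eqP.
  apply: dominates_eq => //; apply/eqP; rewrite eqn_leq leJI andbT.
  by rewrite !card_below; case: (domIJ n).
pose K : Phi n := first_step I J.
have laceK : interlaces K I := first_step_interlaces domIJ ltIJ.
have domKJ : dominates K J := dominates_first_step domIJ ltIJ.
have [] := IHm K _ domKJ; first by case/interlacesP: laceK => ->; lia.
move=> s /andP[/andP[chain_s last_s] rise_s]; exists (K :: s).
rewrite /rising_chain /chain_between /= coversE laceK chain_s last_s /=.
case: s chain_s last_s rise_s => [//|K2 s] /= /andP[covK chain_s] /eqP last_s ->.
rewrite andbT; apply/label_leP=> k; rewrite !psum_label.
have := path_covers_le chain_s; rewrite last_s => /Phi_leP/(_ k)[leK2J _].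
move: covK; rewrite coversE => /interlacesP[_ /(_ k)].
by have := below_first_step k domIJ; rewrite -/K; lia.
Qed.

Lemma rising_chain_unique I J (s s' : seq (Phi n)) :
  rising_chain (@label_le n) (@Phi_label n) I J s ->
  rising_chain (@label_le n) (@Phi_label n) I J s' -> s = s'.
Proof.
have no_loop L K t : covers L K -> path (@covers _ (Phi n)) K t ->
    last K t = L -> False.
  move=> /andP[ltLK _] /path_covers_le + lastL.
  by rewrite lastL => /(lt_le_trans ltLK); rewrite ltxx.
elim: s s' I => [|K s IHs] [|K' s'] I //.
- move=> /andP[/andP[_ /= /eqP <-] _] /andP[/andP[/= /andP[cov chn] /eqP lst] _].
  by case: (no_loop _ _ _ cov chn lst).
- move=> /andP[/andP[/= /andP[cov chn] /eqP lst] _] /andP[/andP[_ /= /eqP eqI] _].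
  by rewrite -eqI in lst; case: (no_loop _ _ _ cov chn lst).
move=> riseK riseK'.
have eqK : K = K'.
  apply: below_inj => k.
  by rewrite (rising_chain_head k riseK) (rising_chain_head k riseK').
rewrite -{K'}eqK in riseK' *; congr (_ :: _); apply: (IHs _ K).
  case/andP: riseK => /andP[/= /andP[_ chn] lst] /path_sorted rise.
  by rewrite /rising_chain /chain_between chn lst.
case/andP: riseK' => /andP[/= /andP[_ chn] lst] /path_sorted rise.
by rewrite /rising_chain /chain_between chn lst.
Qed.

Lemma Phi_EL_labeling : EL_labeling (@Alt n) (@label_le n) (@Phi_label n).
Proof.
split=> [I J|I J leIJ|I J K s riseK Z covZ ltZJ neqZK].
- exact: cover_label_Alt.
- have [s rise_s] := rising_chain_exists leIJ.
  by exists s; split=> // s'; apply: rising_chain_unique.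
apply: strict_labelP => // k; rewrite (rising_chain_head k riseK).
have /Phi_leP/(_ k)[leZJ _] := ltW ltZJ.
by move: covZ; rewrite coversE => /interlacesP[_ /(_ k)]; lia.
Qed.

End Labeling.

(** * Monotone triangles and the weak order *)

Section Triangles.
Variable n : nat.
Implicit Types T : MT n.

Local Notation row := Defs.row.

Lemma size_rows T : size (rows T) = n.+1.
Proof. exact: size_tuple. Qed.

Lemma card_row T m : m <= n -> #|row T m| = m.
Proof.
move=> lemn; have /andP[/forallP/(_ (Ordinal (lemn : m < n.+1)))/eqP + _] := valP T.
by rewrite (tnth_nth set0).
Qed.

Lemma row_interlaces T m : m < n -> interlaces (row T m.+1) (row T m).
Proof.
by move=> ltmn; have /andP[_ /forallP/(_ (Ordinal ltmn))] := valP T.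
Qed.

(** Ranks increase strictly along a chain and only take the n+1 values
    0, ..., n. *)
Lemma size_Phi_chain (c : seq (Phi n)) : sorted <%O c -> size c <= n.+1.
Proof.
move=> srt; rewrite -(size_map (fun I : Phi n => #|I|)) -(size_iota 0 n.+1).
have srt_card : sorted ltn (map (fun I : Phi n => #|I|) c).
  by apply: homo_sorted srt => I J; apply: Phi_lt_card.
apply: uniq_leq_size; first exact: (sorted_uniq ltn_trans ltnn).
move=> _ /mapP[I _ ->].
by have := max_card I; rewrite card_ord mem_iota.
Qed.

Lemma rows_maximal T : maximal_chain (rows T).
Proof.
split=> [|c srt_c sub_c].
  apply/(sortedP set0) => m; rewrite size_rows ltnS => ltmn.
  by have := row_interlaces T ltmn; rewrite -coversE => /andP[].
have [lesz eqc] := size_subseq_leqif sub_c; apply/esym/eqP.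
by rewrite -eqc eqn_leq lesz size_rows size_Phi_chain.
Qed.

(** The set [pi_row T i] is the set of values of m |-> h_m; having i elements
    forces these values to be distinct, so counting elements is counting
    indices, and h_m is at most the m-th entry of row i. *)
Lemma below_pi_row T (i : 'I_n) k :
  0 < i -> #|pi_row T i| = i -> below (row T i) k <= below (pi_row T i) k.
Proof.
move=> lt0i card_pi.
pose h m := maxn (nth 0 (0 :: elts (row T i.-1)) m) (nth 0 (elts (row T i.+1)) m).
have perm_h : perm_eq (elts (pi_row T i)) (mkseq h i).
  have uniq_pi : uniq (elts (pi_row T i)).
    exact: (sorted_uniq ltn_trans ltnn (elts_sorted _)).
  have sub_h : {subset elts (pi_row T i) <= mkseq h i}.
    move=> _ /mapP[x + ->]; rewrite mem_enum inE => /existsP[m /eqP ->].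
    by apply/mapP; exists (val m); rewrite // mem_iota add0n /=.
  have size_h : size (mkseq h i) <= size (elts (pi_row T i)).
    by rewrite size_mkseq size_elts card_pi.
  apply: uniq_perm => //; first exact: leq_size_uniq uniq_pi sub_h size_h.
  by have [] := uniq_min_size uniq_pi sub_h size_h.
have card_i : #|row T i| = i by apply: card_row; apply: ltnW.
rewrite !below_count (permP perm_h) -(mkseq_nth 0 (elts (row T i))).
rewrite size_elts card_i !count_map.
pose t := nth 0 (elts (row T i)).
rewrite (@eq_in_count _ _ (fun m => (m < i) && (t m < k))); last first.
  by move=> m; rewrite mem_iota add0n => /= ->.
apply: sub_count => m /= /andP[ltmi]; apply: leq_ltn_trans.
rewrite /h geq_max; apply/andP; split.
  case: m ltmi => [//|m] ltmi /=.
  have lti1 : i.-1 < n by apply: leq_ltn_trans (leq_pred i) _.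
  have := row_interlaces T lti1; rewrite prednK // => /andP[_ /forallP lace].
  have ltm : m < #|row T i.-1| by rewrite (card_row T (ltnW lti1)) -ltnS prednK.
  by have /andP[] := lace (Ordinal ltm).
have /andP[_ /forallP lace] := row_interlaces T (ltn_ord i).
by rewrite -card_i in ltmi; have /andP[] := lace (Ordinal ltmi).
Qed.

Lemma lex_before_nth (L : eqType) (leL : rel L) (x0 : L) (s t : seq L) j :
  size s = size t -> j < size s ->
  (forall m, m < j -> nth x0 s m = nth x0 t m) ->
  strict leL (nth x0 s j) (nth x0 t j) -> lex_before leL s t.
Proof.
move=> eqsz ltj agree lt_st.
exists (take j s), (nth x0 s j), (nth x0 t j), (drop j.+1 s), (drop j.+1 t).
split=> //; first by rewrite -drop_nth ?cat_take_drop.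
have -> : take j s = take j t.
  apply: (@eq_from_nth _ x0); rewrite !size_takel -?eqsz 1?ltnW // => m ltm.
  by rewrite !nth_take ?agree.
by rewrite -drop_nth ?cat_take_drop -?eqsz.
Qed.

Lemma size_labels_rows T : size (labels (@Phi_label n) (rows T)) = n.
Proof.
have := size_rows T; case: (rows T) => [//|I s] /= [sz].
by rewrite size_pairmap sz.
Qed.

Lemma nth_labels_rows T m :
  m < n -> nth 0%R (labels (@Phi_label n) (rows T)) m =
           Phi_label (row T m) (row T m.+1).
Proof.
rewrite /row; have := size_rows T; case: (rows T) => [//|I s] /= [sz] ltmn.
by rewrite (nth_pairmap (set0 : Phi n)) ?sz.
Qed.

Lemma weak_step_lex T' T :
  weak_step T' T -> T' = T \/
  lex_before (@label_le n) (labels (@Phi_label n) (rows T'))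
                           (labels (@Phi_label n) (rows T)).
Proof.
case/existsP=> i /andP[lt0i /eqP rowsT'].
have rowT' m : row T' m = if m == i then pi_row T i else row T m.
  by rewrite /row rowsT' nth_set_nth /=; case: eqP.
have [eqTT'|neqTT'] := eqVneq T' T; [by left | right].
have lti1 : i.-1 < n by apply: leq_ltn_trans (leq_pred i) _.
have card_pi : #|pi_row T i| = i.
  by have := card_row T' (ltnW (ltn_ord i)); rewrite rowT' eqxx.
apply: (@lex_before_nth _ _ 0%R _ _ i.-1); rewrite ?size_labels_rows //.
  move=> m ltm; rewrite !nth_labels_rows ?(ltn_trans ltm) // !rowT'.
  by rewrite !ifN //; apply/eqP; lia.
rewrite !nth_labels_rows // prednK // !rowT' eqxx ifN; last by apply/eqP; lia.
apply: strict_labelP => [|k]; last exact: below_pi_row.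
apply: contraNneq neqTT' => eq_row; apply/eqP/val_inj/val_inj.
apply: (@eq_from_nth _ set0); rewrite ?size_rows // => m _.
by rewrite -!/(row _ _) rowT'; case: eqP => [->|].
Qed.

End Triangles.

Theorem theorem1p2 (n : nat) (hn : (1 <= n)%N) :
  exists leA : rel 'rV[int]_n,
    [/\ partial_order_on (@Alt n) leA,
        EL_labeling (@Alt n) leA (@Phi_label n)
      & forall r : rel (seq (Phi n)),
          EL_shelling_order leA (@Phi_label n) r ->
          let rMT : rel (MT n) := relpre (@rows n) r in
          linear_order_on predT rMT /\ extends_weak_order rMT].
Proof.
exists (@label_le n).
split; [exact: label_le_order | exact: Phi_EL_labeling |].
move=> r [refl anti trans tot lex] rMT; have maxT := @rows_maximal n.
split=> [|T' T].
  split=> [|T' T _ _]; last exact: tot.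
  split=> [T _|T' T _ _ /andP[rT'T rTT']|T2 T1 T3 _ _ _]; first exact: refl.
    by apply/val_inj/val_inj; apply: anti rT'T rTT'.
  exact: trans.
case/andP=> -> /connectP[s + ->] /=.
elim: s T' => [|T2 s IHs] T' /=; first by move=> _; apply: refl.
case/andP=> /weak_step_lex step /IHs; case: step => [-> //|/lex rT'T2].
by apply: trans => //; apply: rT'T2.
Qed.
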